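(* Let $q$ be a prime power. If $q \equiv 1 \pmod 4$, $q$ is odd, and $r=\frac{q-1}{2}\ge 2$ is prime, then \[\mathrm{Prob}_r(\mathrm{PSL}(2,q))=\frac{r+1}{2r}.\] In particular, if $r=2$, then $\mathrm{Prob}_2(\mathrm{PSL}(2,q))=\frac{3}{4}$.
   Context: For a finite group $G$ and an integer $r\ge 2$, let $G^r=\{g^r \mid g\in G\}$ be the set of all elements of $G$ having at least one $r$-th root in $G$ (a subset of $G$, in general not a subgroup), and define $\mathrm{Prob}_r(G)=\frac{|G^r|}{|G|}$. Here $\mathrm{PSL}(2,q)=\mathrm{SL}(2,q)/Z(\mathrm{SL}(2,q))$ is the projective special linear group of degree $2$ over the field with $q$ elements. *)

(* Defs.v *)
From HB Require Import structures.
From mathcomp Require Import all_boot all_order all_algebra.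
From mathcomp Require Import all_fingroup all_solvable.

Set Implicit Arguments.
Unset Strict Implicit.
Unset Printing Implicit Defensive.

Import GRing.Theory.

Section SpecialLinear.

Variables (n : nat) (F : finFieldType).

(* [{'GL_n[F]}] is made of matrices of size [n.-1.+1], so [n] is meant to be
   positive. *)
Definition SL : {set {'GL_n[F]}} := [set A : {'GL_n[F]} | (\det (GLval A) == 1)%R].

Lemma SL_group_set : group_set SL.
Proof.
apply/group_setP; split=> [|A B]; first by rewrite inE GL_1E det1.
by rewrite !inE GL_ME det_mulmx => /eqP-> /eqP->; rewrite mulr1.
Qed.

Canonical SL_group := Group SL_group_set.

Definition PSL : {set coset_of 'Z(SL)} := (SL / 'Z(SL))%g.

Canonical PSL_group := Eval hnf in [group of PSL].

End SpecialLinear.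

Section Roots.

Variables (gT : finGroupType) (r : nat) (G : {group gT}).

Definition rth_powers : {set gT} := [set (g ^+ r)%g | g in G].

Definition Prob : rat := (#|rth_powers|%:R / #|G|%:R)%R.

End Roots.

(* Main.v *)
(** Since [q = 1 %[mod 4]], the prime [r = (q - 1) / 2] is even, so [r = 2] and
    [q = 5].  By Cayley-Hamilton, [A] in SL(2, F) satisfies
    [A^2 = t A - 1] with [t = \tr A], hence [\tr (A^2) = t^2 - 2], which is
    nonzero in a field of order 5, and [(A + 1)^2 = (t + 2) A], so that [A] is a
    square whenever [t + 2] is a nonzero square.  Over a field of order 5, if
    [t != 0] then this applies to [A] or to [- A].  The squares of PSL(2, 5) are
    thus the images of the 90 matrices of nonzero trace among the 120 elements
    of SL(2, 5). *)

Require Import Defs.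
From mathcomp Require Import all_boot all_order all_algebra.
From mathcomp Require Import all_fingroup all_solvable.
From mathcomp Require Import all_field zify ring.

Set Implicit Arguments.
Unset Strict Implicit.
Unset Printing Implicit Defensive.

Import GRing.Theory.

(** Stability under left multiplication by [N] makes every fibre of [coset N] over [T] a full right
    coset, with [#|N|] elements. *)
Lemma card_quotient_imset (gT : finGroupType) (N : {group gT}) (T : {set gT}) :
    T \subset 'N(N)%g -> (forall x n, x \in T -> n \in N -> (n * x)%g \in T) ->
  #|coset N @: T| * #|N| = #|T|.
Proof.
move=> nNT T_N; rewrite -[RHS]sum1_card (partition_big_imset (coset N)) /=.
rewrite -sum_nat_const; apply: eq_bigr => _ /imsetP[x Tx ->].
rewrite sum1dep_card -(card_rcoset N x); apply: eq_card => y; rewrite inE.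
apply/idP/andP=> [/rcosetP[n Nn ->] | [Ty /eqP eq_yx]].
  by split; [exact: T_N | rewrite coset_kerl].
have [nNx nNy] := (subsetP nNT _ Tx, subsetP nNT _ Ty).
exact/(rcoset_kercosetP nNy nNx).
Qed.

(** * Trace and determinant identities for matrices of size 2 *)

Section TwoByTwo.

Variable R : comNzRingType.
Implicit Types A B : 'M[R]_2.
Local Open Scope ring_scope.

Lemma ord2P (P : 'I_2 -> Prop) : P 0 -> P 1 -> forall i, P i.
Proof.
move=> P0 P1 [[|[|m]] // lt_m2].
  by rewrite (_ : Ordinal _ = 0) //; apply: val_inj.
by rewrite (_ : Ordinal _ = 1) //; apply: val_inj.
Qed.

Lemma big_ord2 (f : 'I_2 -> R) : \sum_i f i = f 0 + f 1.
Proof.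
by rewrite !big_ord_recl big_ord0 addr0; congr (_ + f _); apply: val_inj.
Qed.

Lemma det_mx2 A : \det A = A 0 0 * A 1 1 - A 0 1 * A 1 0.
Proof.
rewrite (expand_det_row A 0) big_ord2 /cofactor !det_mx11 !mxE /=.
have -> : lift 0 0 = 1 :> 'I_2 by apply: val_inj.
have -> : lift 1 0 = 0 :> 'I_2 by apply: val_inj.
by rewrite expr0 expr1; ring.
Qed.

Lemma tr_mx2 A : \tr A = A 0 0 + A 1 1.
Proof. exact: big_ord2. Qed.

Lemma mulmx2E A B i j : (A *m B) i j = A i 0 * B 0 j + A i 1 * B 1 j.
Proof. by rewrite mxE big_ord2. Qed.

Lemma mulmx2_sqr A : A *m A = \tr A *: A - (\det A)%:M.
Proof.
apply/matrixP=> i j; rewrite mulmx2E det_mx2 tr_mx2 !mxE.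
by move: i j; do 2!apply: ord2P => //=; rewrite ?mulr1n ?mulr0n; ring.
Qed.

(** This is the characteristic polynomial of [A] evaluated at -1. *)
Lemma det_addmx1 A : \det (A + 1%:M) = \det A + \tr A + 1.
Proof. by rewrite !det_mx2 tr_mx2 !mxE /= ?mulr1n ?mulr0n; ring. Qed.

End TwoByTwo.

(** * Centre, enumeration and square roots in SL(2, F) *)

Section SpecialLinear2.

Variable F : finFieldType.
Local Open Scope ring_scope.

Lemma mem_SL (A : {'GL_2[F]}) : (A \in SL 2 F) = (\det (GLval A) == 1).
Proof. by rewrite inE. Qed.

Lemma SL_of_det1 (M : 'M[F]_2) : \det M = 1 -> {A | A \in SL 2 F & GLval A = M}.
Proof.
move=> detM; have uM : M \is a GRing.unit by rewrite unitmxE detM unitr1.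
by exists (Sub M uM); rewrite ?inE /= ?detM.
Qed.

(** Commuting with two unipotent matrices, one upper and one lower triangular, already forces a
    matrix to be scalar; determinant 1 then leaves the roots of x^2 = 1. *)
Lemma center_SL2P (z : {'GL_2[F]}) :
  reflect (GLval z = 1%:M \/ GLval z = (- 1)%:M) (z \in 'Z(SL 2 F)%g).
Proof.
apply: (iffP idP) => [/centerP[] | z_pm1].
  rewrite mem_SL => /eqP detz zC.
  pose upper : 'M[F]_2 := \matrix_(i, j) (i <= j)%:R.
  pose lower : 'M[F]_2 := \matrix_(i, j) (j <= i)%:R.
  have [u SLu uE] : {A | A \in SL 2 F & GLval A = upper}.
    by apply: SL_of_det1; rewrite det_mx2 !mxE /=; ring.
  have [l SLl lE] : {A | A \in SL 2 F & GLval A = lower}.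
    by apply: SL_of_det1; rewrite det_mx2 !mxE /=; ring.
  have /(congr1 (fun A => GLval A)) := zC u SLu.
  have /(congr1 (fun A => GLval A)) := zC l SLl.
  rewrite !GL_MxE uE lE; move: detz.
  move: (GLval z) => {uE lE}M; rewrite det_mx2 => detM /matrixP zl /matrixP zu.
  (* These three entries give [M 0 1 = 0], [M 1 0 = 0] and [M 0 0 = M 1 1] in turn. *)
  have := (zl 0 0, zu 0 0, zu 0 1); rewrite !mulmx2E !mxE /=.
  rewrite ?mulr1n ?mulr0n !(mulr1, mul1r, mulr0, mul0r, addr0, add0r).
  case=> [[e1 e2] e3].
  have M01 : M 0 1 = 0.
    by apply: (addrI (M 0 0)); rewrite e1 addr0.
  have M10 : M 1 0 = 0.
    by apply: (addrI (M 0 0)); rewrite -e2 addr0.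
  have M11 : M 1 1 = M 0 0 by move: e3; rewrite M01 addr0 add0r.
  have : M 0 0 ^+ 2 == 1 by rewrite -detM M01 M11 mul0r subr0.
  rewrite sqrf_eq1 => /orP[]/eqP M00; [left | right]; apply/matrixP;
    by do 2!apply: ord2P; rewrite !mxE /= ?M11 ?M01 ?M10 ?M00 ?mulr1n.
apply/centerP; split.
  by rewrite mem_SL; case: z_pm1 => ->; rewrite det_scalar ?expr1n // sqrrN expr1n.
move=> A _; apply: val_inj; rewrite [LHS]GL_MxE [RHS]GL_MxE.
by case: z_pm1 => ->; rewrite scalar_mxC.
Qed.

Lemma SL2_sqr (A B : {'GL_2[F]}) : B \in SL 2 F ->
  GLval (B ^+ 2)%g = \tr (GLval B) *: GLval B - 1%:M.
Proof. by rewrite mem_SL expgS expg1 GL_MxE mulmx2_sqr => /eqP->. Qed.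

(** A matrix is identified with its four entries. The determinant condition avoids subtraction so
    that it can later be read on natural numbers. *)
Lemma card_SL2_trace_sum (P : pred F) :
  #|[set A in SL 2 F | P (\tr (GLval A))]| =
    (\sum_(a : F) \sum_(b : F) \sum_(c : F) \sum_(d : F)
       ((a * d == 1 + b * c) && P (a + d))%R : nat)%N.
Proof.
pose entries (A : {'GL_2[F]}) :=
  (((GLval A 0 0, GLval A 0 1), GLval A 1 0), GLval A 1 1).
have entries_inj : injective entries.
  move=> A B [e00 e01 e10 e11]; apply/val_inj/matrixP.
  by do 2!apply: ord2P.
rewrite -(card_imset _ entries_inj).
pose Q (t : F * F * F * F) :=
  (t.1.1.1 * t.2 == 1 + t.1.1.2 * t.1.2) && P (t.1.1.1 + t.2).
transitivity #|[set t | Q t]|.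
  apply: eq_card => -[[[a b] c] d]; rewrite inE /Q /=.
  apply/imsetP/andP=> [[A] | [adbc Pad]].
    rewrite !inE det_mx2 tr_mx2 => /andP[detA PA] [-> -> -> ->].
    by rewrite -subr_eq.
  pose M : 'M[F]_2 := \matrix_(i, j)
    if i == 0 then (if j == 0 then a else b) else (if j == 0 then c else d).
  have [|A SLA AE] := @SL_of_det1 M.
    by rewrite det_mx2 !mxE /=; apply/eqP; rewrite subr_eq.
  by exists A; rewrite /entries ?inE -?mem_SL ?SLA AE ?tr_mx2 !mxE.
rewrite -sum1dep_card big_mkcond /= !pair_bigA /=.
by apply: eq_bigr => t _; rewrite /Q; case: (_ && _).
Qed.

Lemma SL2_sqr_trace (A : {'GL_2[F]}) (c : F) :
    A \in SL 2 F -> c != 0 -> \tr (GLval A) + 2%:R = c ^+ 2 ->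
  exists2 B, B \in SL 2 F & A = (B ^+ 2)%g.
Proof.
move=> SLA nz_c trA; have /eqP detA : \det (GLval A) == 1 by rewrite -mem_SL.
(* The root is [A + 1] rescaled: its determinant is [\tr A + 2 = c ^+ 2], so division by [c] brings
   it to 1. *)
have [|B SLB BE] := @SL_of_det1 (c^-1 *: (GLval A + 1%:M)).
  have detA1 : \det (GLval A) + \tr (GLval A) + 1 = c ^+ 2.
    by rewrite -trA detA; ring.
  by rewrite detZ det_addmx1 detA1 -exprMn mulVf // expr1n.
exists B => //; apply: val_inj.
rewrite expgS expg1 [RHS]GL_MxE BE -scalemxAl -scalemxAr scalerA.
have -> : (GLval A + 1%:M) *m (GLval A + 1%:M) = c ^+ 2 *: GLval A.
  rewrite mulmxDl mul1mx mulmxDr mulmx1 mulmx2_sqr detA -trA.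
  by apply/matrixP=> i j; rewrite !mxE; ring.
by rewrite scalerA -expr2 -exprMn mulVf // expr1n scale1r.
Qed.

End SpecialLinear2.

(** * Counting over the field of order 5 *)

Section Order5.

Variable F : finFieldType.
Hypothesis cardF : #|F| = 5.
Local Open Scope ring_scope.

Lemma eqr_nat5 m n : (m%:R == n%:R :> F) = (m == n %[mod 5])%N.
Proof.
have pcharF : 5 \in [pchar F] by apply: (@card_finPcharP F 5 1).
(* With [n <= m], the truncated [m - n] maps to the true difference in [F]. *)
wlog le_nm : m n / (n <= m)%N => [hwlog | ].
  by have [/hwlog//|/ltnW/hwlog] := leqP n m; rewrite eq_sym => ->; rewrite eq_sym.
by rewrite eqn_mod_dvd // (dvdn_pcharf pcharF) natrB // subr_eq0.
Qed.

(** Five distinct numerals exhaust a field with five elements; sums over [F] thereby become sums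
    over [iota 0 5]. *)
Lemma perm_index_enum5 : perm_eq (index_enum F) [seq n%:R | n <- iota 0 5].
Proof.
have Us : uniq [seq n%:R : F | n <- iota 0 5].
  by rewrite map_inj_in_uniq ?iota_uniq // => m n; rewrite !mem_iota /= => lt_m lt_n
    /eqP; rewrite eqr_nat5 !modn_small // => /eqP.
have [||_ eq_s] := uniq_min_size Us (s2 := index_enum F).
- by move=> x _; rewrite mem_index_enum.
- by rewrite size_map size_iota -cardF cardT enumT.
by rewrite perm_sym uniq_perm ?index_enum_uniq.
Qed.

Lemma big_field5 (f : F -> nat) :
  (\sum_x f x = \sum_(n <- iota 0 5) f n%:R)%N.
Proof. by rewrite (perm_big _ perm_index_enum5) big_map. Qed.

Lemma field5_ind (P : F -> Prop) :
  P 0 -> P 1 -> P 2%:R -> P 3%:R -> P 4%:R -> forall x, P x.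
Proof.
move=> P0 P1 P2 P3 P4 x; have := mem_index_enum x.
by rewrite (perm_mem perm_index_enum5) !inE => /or4P[|||/orP[]]/eqP->.
Qed.

(** Once the predicate on traces is read on numerals, the count is closed arithmetic modulo 5 that
    can be evaluated. *)
Lemma card_SL2_trace (P : pred F) (Q : pred nat) :
    (forall n, P n%:R = Q n) ->
  #|[set A in SL 2 F | P (\tr (GLval A))]| =
    (\sum_(a <- iota 0 5) \sum_(b <- iota 0 5) \sum_(c <- iota 0 5)
      \sum_(d <- iota 0 5) ((a * d == 1 + b * c %[mod 5]) && Q (a + d)%N : nat))%N.
Proof.
move=> PQ; rewrite card_SL2_trace_sum.
do 4![rewrite big_field5; apply: eq_bigr => ? _].
by rewrite -PQ -!natrM -!natrD -(natrD _ 1) eqr_nat5.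
Qed.

Lemma card_SL2_5 : #|SL 2 F| = 120.
Proof.
transitivity #|[set A in SL 2 F | predT (\tr (GLval A))]|.
  by apply: eq_card => A; rewrite !inE andbT.
(* Unlocking the big operators lets the 625 terms be computed. *)
by rewrite (@card_SL2_trace _ predT) // unlock; vm_compute.
Qed.

Lemma card_SL2_5_trace_neq0 : #|[set A in SL 2 F | \tr (GLval A) != 0]| = 90.
Proof.
rewrite (@card_SL2_trace (fun x => x != 0) (fun n => n %% 5 != 0)%N).
  by rewrite unlock; vm_compute.
by move=> n; rewrite -[0]/(0%:R) eqr_nat5.
Qed.

(** The squares modulo 5 are 0, 1 and 4. *)
Lemma sqr_neq2_5 (t : F) : t ^+ 2 - 2%:R != 0.
Proof.
rewrite subr_eq0; move: t; apply: field5_ind.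
- by rewrite expr0n eqr_nat5.
- by rewrite expr1n -[1]/(1%:R) eqr_nat5.
all: by rewrite -natrX eqr_nat5.
Qed.

(** The nonzero squares are 1 and 4: [t + 2] reaches them at t = 4 and 2, and [- t + 2] at t = 1 and
    3. *)
Lemma trace_sqr5 (t : F) : t != 0 ->
  exists2 c : F, c != 0 & (t + 2%:R = c ^+ 2) \/ (- t + 2%:R = c ^+ 2).
Proof.
have nat_sqr m n : (m == n ^ 2 %[mod 5])%N -> m%:R = n%:R ^+ 2 :> F.
  by rewrite -natrX -eqr_nat5 => /eqP.
have nat_sqrN k m n : (m == n ^ 2 + k %[mod 5])%N ->
    - k%:R + m%:R = n%:R ^+ 2 :> F.
  by rewrite -natrX -eqr_nat5 natrD => /eqP->; rewrite addrC addrK.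
have nz2 : 2%:R != 0 :> F by rewrite -[0]/(0%:R) eqr_nat5.
move: t; apply: field5_ind; first by rewrite eqxx.
- by exists 1; rewrite ?oner_neq0 //; right; apply: (nat_sqrN 1 2 1).
- by exists 2%:R => //; left; rewrite -natrD; apply: nat_sqr.
- by exists 2%:R => //; right; apply: nat_sqrN.
- by exists 1; rewrite ?oner_neq0 //; left; rewrite -natrD; apply: (nat_sqr _ 1).
Qed.

Lemma PSL2_5_squares :
  rth_powers 2 (PSL_group 2 F) =
    coset 'Z(SL 2 F)%g @: [set A in SL 2 F | \tr (GLval A) != 0].
Proof.
have nZ A : A \in SL 2 F -> A \in 'N('Z(SL 2 F))%g.
  exact/subsetP/normal_norm/center_normal.
apply/setP=> x; apply/imsetP/imsetP=> [[_ /morphimP[B nB SLB ->] ->] | [A]].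
  exists (B ^+ 2)%g; last by rewrite morphX.
  rewrite inE groupX // andTb SL2_sqr // raddfB /= mxtraceZ mxtrace_scalar -expr2.
  exact: sqr_neq2_5.
rewrite inE => /andP[SLA /trace_sqr5[c nz_c trA]] ->.
(* The central element -1 flips the sign of the trace without changing the image in PSL. *)
have [|z SLz zE] := @SL_of_det1 F (- 1)%:M; first by rewrite det_scalar sqrrN expr1n.
have Zz : z \in 'Z(SL 2 F)%g by apply/center_SL2P; right.
have [A' SLA' [-> trA']] : exists2 A', A' \in SL 2 F &
    coset 'Z(SL 2 F)%g A = coset 'Z(SL 2 F)%g A' /\ \tr (GLval A') + 2%:R = c ^+ 2.
  case: trA => trA; first by exists A.
  exists (z * A)%g; first exact: (groupM SLz SLA).
  split; first by rewrite coset_kerl.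
  by rewrite GL_MxE zE mul_scalar_mx mxtraceZ mulN1r.
have [B SLB ->] := SL2_sqr_trace SLA' nz_c trA'.
exists (coset 'Z(SL 2 F)%g B); first exact/mem_morphim/SLB/nZ.
by rewrite morphX ?nZ.
Qed.

Lemma Prob2_PSL2_5 : Prob 2 (PSL_group 2 F) = 3 / 4.
Proof.
set Z := 'Z(SL 2 F)%G.
have nZ : SL 2 F \subset 'N(Z)%g by apply/normal_norm/center_normal.
have ZSL : {subset Z <= SL 2 F} by apply/subsetP/center_sub.
(* Both cardinals are computed times [#|Z|], which cancels in the ratio 90 / 120. *)
have cardP : (#|rth_powers 2 (PSL_group 2 F)| * #|Z|)%N = 90.
  rewrite PSL2_5_squares card_quotient_imset ?card_SL2_5_trace_neq0 //.
    by apply: subset_trans nZ; apply/subsetP=> A; rewrite inE => /andP[].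
  (* Central elements are 1 and -1, so they preserve the nonvanishing of the trace. *)
  move=> A z; rewrite inE => /andP[SLA trA] Zz.
  rewrite inE (groupM (ZSL z Zz) SLA) andTb GL_MxE.
  have /center_SL2P[->|->] := Zz; rewrite mul_scalar_mx mxtraceZ ?mul1r //.
  by rewrite mulN1r oppr_eq0.
have cardG : (#|PSL_group 2 F| * #|Z|)%N = 120.
  by rewrite -card_SL2_5 card_quotient // mulnC Lagrange ?center_sub.
rewrite /Prob; move: cardP cardG (cardG_gt0 Z).
move: #|_| #|PSL_group 2 F| #|Z| => a b z az bz z_gt0.
have : (4 * a = 3 * b)%N by nia.
have : b != 0%N by case: b bz.
move=> nzb /(congr1 (fun n => n%:R : rat)); rewrite !natrM => e.
have nzbQ : b%:R != 0 :> rat by rewrite Num.Theory.pnatr_eq0.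
apply/eqP; rewrite eqr_div //; apply/eqP; rewrite mulrC; exact: e.
Qed.

End Order5.

Theorem theorem3p1 (p k q r : nat) (F : finFieldType)
    (p_prime : prime p) (k_gt0 : 0 < k) (q_def : q = p ^ k) (cardF : #|F| = q)
    (q_mod4 : q = 1 %[mod 4]) (q_odd : odd q)
    (r_def : r = (q - 1) %/ 2) (r_ge2 : 2 <= r) (r_prime : prime r) :
  Prob r (PSL_group 2 F) = ((r%:R + 1) / (2 * r%:R))%R
  /\ (r = 2 -> Prob 2 (PSL_group 2 F) = (3 / 4)%R).
Proof.
have r_even : ~~ odd r by lia.
have r2 : r = 2 by have [|/idPn] := even_prime r_prime.
have {}cardF : #|F| = 5 by lia.
(* At [r = 2] the value (r + 1) / (2r) is 3/4, so both conjuncts express the same count. *)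
by rewrite r2 Prob2_PSL2_5.
Qed.
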